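(* Let $r\ge2$ be a fixed integer, $a>b>0$ fixed, $n=rK$, and suppose $\sqrt a-\sqrt b<\sqrt r$. In the stochastic block model with $r$ clusters of equal size $K$, suppose the clusters are chosen uniformly at random among all partitions of $[n]$ into $r$ sets of size $K$. Then for any sequence of estimators $\widehat Z_n$ (functions of $A$), $\mathbb P\{\widehat Z_n=Z^*\}\to0$ as $n\to\infty$.
   Context: SBM with $r$ equal-sized clusters: given the partition of $[n]$ into clusters with indicator vectors $\xi^*_1,\dots,\xi^*_r$, each pair $\{i,j\}$ is independently connected with probability $p=a\log n/n$ if in the same cluster and $q=b\log n/n$ otherwise; $A$ is the adjacency matrix and $Z^*=\sum_k\xi^*_k(\xi^*_k)^\top$. *)

(* Defs.v *)
From Stdlib Require Import Reals ClassicalEpsilon.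
From mathcomp Require Import all_boot.
Set Implicit Arguments. Unset Strict Implicit. Unset Printing Implicit Defensive.

Definition balanced_partition (n r K : nat) (P : {set {set 'I_n}}) : bool :=
  [&& partition P [set: 'I_n], #|P| == r & [forall B in P, #|B| == K]].

(* Z* = sum_k xi_k xi_k^T, xi_k the indicator vector of cluster k. *)
Definition Zstar (n : nat) (P : {set {set 'I_n}}) (i j : 'I_n) : R :=
  \big[Rplus/R0]_(B in P) (Rmult (if i \in B then R1 else R0) (if j \in B then R1 else R0)).

Definition adjmat (n : nat) := {ffun 'I_n * 'I_n -> bool}.

Definition adj_valid (n : nat) (A : adjmat n) : bool :=
  [forall i : 'I_n, ~~ A (i, i)] && [forall i : 'I_n, forall j : 'I_n, A (i, j) == A (j, i)].

Definition p_in (a : R) (n : nat) : R := Rdiv (Rmult a (ln (INR n))) (INR n).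

Definition sbm_prob (n : nat) (a b : R) (P : {set {set 'I_n}}) (A : adjmat n) : R :=
  if adj_valid A then
    \big[Rmult/R1]_(i : 'I_n) \big[Rmult/R1]_(j : 'I_n | (i < j)%N)
      (let w := if pblock P i == pblock P j then p_in a n else p_in b n in
       if A (i, j) then w else Rminus R1 w)
  else R0.

Definition indicator (P : Prop) : R :=
  if excluded_middle_informative P then R1 else R0.

Definition success_prob (r K : nat) (a b : R)
  (Zhat : adjmat (r * K) -> 'I_(r * K) -> 'I_(r * K) -> R) : R :=
  Rmult (Rinv (INR #|[set P : {set {set 'I_(r * K)}} | balanced_partition r K P]|))
   (\big[Rplus/R0]_(P : {set {set 'I_(r * K)}} | balanced_partition r K P)
     \big[Rplus/R0]_(A : adjmat (r * K))
        (Rmult (sbm_prob a b P A) (indicator (Zhat A = Zstar P)))).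
Arguments success_prob : clear implicits.

(* Main.v *)
(** The success probability of any estimator is at most [1/t] plus the
    probability that fewer than [t] balanced partitions have the same likelihood
    as the true one.  Let [H1], [H2] be a small fraction of two clusters
    [C1], [C2], and call a vertex of [H1] or [H2] good if it has no neighbour in
    [H1 :|: H2] and exactly [k] neighbours in each of [C1] and [C2].  Swapping a
    good vertex of [H1] with a good vertex of [H2] preserves the likelihood, so
    there are at least as many ties as pairs of good vertices.  Two vertices of
    [H1] are good independently up to the factor [1 / (1 - p)] coming from their
    common edge, so Chebyshev's inequality shows that the number of good vertices
    is at least half its mean.  For [k] close to [sqrt (a * b) / r * ln n] a vertex
    is good with probability [n ^ (- (sqrt a - sqrt b) ^ 2 / r - o(1))], and the mean
    tends to infinity since [(sqrt a - sqrt b) ^ 2 < r]. *)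
Require Import Defs.
From Stdlib Require Import ZArith Reals Lra ClassicalEpsilon.
From mathcomp Require Import all_boot all_order all_algebra all_fingroup.
From mathcomp Require Import Rstruct.
Set Implicit Arguments. Unset Strict Implicit. Unset Printing Implicit Defensive.
Import Order.TTheory GRing.Theory Num.Theory.

(** * The expected number of exchangeable vertices *)

Lemma leq_pow_ffact m k : ((m - k) ^ k <= m ^_ k)%N.
Proof.
rewrite ffact_prod -[X in (_ ^ X)%N]card_ord -prod_nat_const.
by apply: leq_prod => i _; rewrite leq_sub2l // ltnW.
Qed.

Section Asymptotics.
Local Open Scope R_scope.

Lemma pow_le_bin_fact m k : pow (INR (m - k)) k <= INR 'C(m, k) * INR k`!.
Proof.
rewrite !INRE RpowE RmultE -natrX -natrM bin_ffact; apply/RleP.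
by rewrite ler_nat leq_pow_ffact.
Qed.

Lemma exp_INR_mul x n : exp (INR n * x) = exp x ^ n.
Proof.
elim: n => [|n IH]; first by rewrite /= Rmult_0_l exp_0.
by rewrite S_INR Rmult_plus_distr_r Rmult_1_l exp_plus IH /= Rmult_comm.
Qed.

(** This is the Stirling-type bound m! <= e m (m / e)^m with m = k + 1. The induction step reduces
    to (1 - 1/m)^m <= 1/e, obtained from 1 + u <= exp u at u = -1/m. *)
Lemma fact_le k : INR k.+1`! <= INR k.+1 * pow (INR k.+1) k.+1 * exp (- INR k).
Proof.
elim: k => [|k IH]; first by rewrite /= Ropp_0 exp_0; lra.
rewrite factS mulnE mult_INR.
have xpos := pos_INR k.
have k1 : INR k.+1 = INR k + 1 by rewrite S_INR.
have k2 : INR k.+2 = INR k + 2 by rewrite !S_INR; lra.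
have e1 : INR k.+1 <= INR k.+2 * exp (- / INR k.+2).
  have := exp_ineq1_le (- / INR k.+2) => h.
  have : INR k.+2 * (1 + - / INR k.+2) <= INR k.+2 * exp (- / INR k.+2).
    by apply: Rmult_le_compat_l => //; lra.
  have -> : INR k.+2 * (1 + - / INR k.+2) = INR k.+1 by rewrite k1 k2; field; lra.
  by [].
have e2 : pow (INR k.+1) k.+2 <= pow (INR k.+2) k.+2 * exp (-1).
  have -> : exp (-1) = pow (exp (- / INR k.+2)) k.+2.
    by rewrite -exp_INR_mul; congr exp; field; lra.
  rewrite -Rpow_mult_distr; apply: pow_incr; split => //; lra.
have e3 : exp (- INR k.+1) = exp (- INR k) * exp (-1) by rewrite -exp_plus; congr exp; lra.
rewrite Rmult_assoc; apply: Rmult_le_compat_l; first by lra.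
apply: (Rle_trans _ _ _ IH); rewrite e3.
have p0 := exp_pos (- INR k).
have -> : INR k.+1 * INR k.+1 ^ k.+1 = INR k.+1 ^ k.+2 by [].
nra.
Qed.

(** Multiply by exp (p (1 + e)) >= 1 + p (1 + e): the product (1 - p)(1 + p (1 + e)) equals 1 + p (e
    - p (1 + e)), which is at least 1. *)
Lemma one_minus_ge_exp (p e : R) : 0 <= p -> 0 < e -> p * (1 + e) <= e ->
  exp (- (p * (1 + e))) <= 1 - p.
Proof.
move=> p0 e0 pe.
have p1 : 0 < 1 - p by nra.
rewrite exp_Ropp; apply: Rmult_le_reg_l (exp_pos (p * (1 + e))) _.
rewrite Rinv_r; last by have := exp_pos (p * (1 + e)); lra.
have := exp_ineq1_le (p * (1 + e)); nra.
Qed.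

(** The mean is bounded below by a multiple of exp (d L) / L^2; a cubic bound on the exponential
    cancels L^2 and leaves a factor L that tends to infinity. *)
Lemma cube_le_exp x : 0 <= x -> x ^ 3 / 27 <= exp x.
Proof.
move=> x0; have -> : exp x = exp (x / 3) ^ 3 by rewrite -exp_INR_mul /=; congr exp; field.
have -> : x ^ 3 / 27 = (x / 3) ^ 3 by field.
by apply: pow_incr; have := exp_ineq1_le (x / 3); lra.
Qed.

(** At x = ln n this gives (ln n)^2 / 4 <= n, which makes p of order 1 / ln n at most and ln n small
    against K. *)
Lemma square_le_exp x : 0 <= x -> x ^ 2 / 4 <= exp x.
Proof.
move=> x0; have -> : exp x = exp (x / 2) ^ 2 by rewrite -exp_INR_mul /=; congr exp; field.
have -> : x ^ 2 / 4 = (x / 2) ^ 2 by field.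
by apply: pow_incr; have := exp_ineq1_le (x / 2); lra.
Qed.

Lemma nat_floor_ex x : 0 <= x -> exists n : nat, INR n <= x < INR n + 1.
Proof.
move=> x0; have [h1 h2] := base_Int_part x.
have z0 : Z.le Z0 (Int_part x).
  by apply: (proj1 (Z.lt_succ_r _ _)); apply: lt_IZR; rewrite succ_IZR; lra.
by exists (Z.to_nat (Int_part x)); rewrite INR_IZR_INZ Z2Nat.id //; lra.
Qed.

(** Since C(m, k) >= (m - k)^k / k! and k! <= k k^k exp (1 - k), the right side is at least ((m -
    k)^2 x / k^2)^k times the left side, and the hypothesis makes that power at least 1. It is
    applied with x = p q. *)
Lemma bin_weight_ge (m k : nat) (x : R) : (0 < k)%N -> 0 <= x ->
  INR k ^ 2 <= INR (m - k) ^ 2 * x ->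
  exp (2 * INR k - 2) / INR k ^ 2 <= INR 'C(m, k) ^ 2 * x ^ k.
Proof.
case: k => // k _ x0 kx.
have kpos : 0 < INR k.+1 by apply: lt_0_INR; apply/ssrnat.ltP.
have f := fact_le k; have b := pow_le_bin_fact m k.+1.
set B := INR 'C(m, k.+1) in b *; set f1 := INR k.+1`! in f b.
set y := INR k.+1 in f kx kpos *; set z := INR (m - k.+1) in b kx *.
have z0 : 0 <= z by apply: pos_INR.
have B0 : 0 <= B by apply: pos_INR.
have y1 : 0 < y ^ k.+1 by apply: pow_lt.
have E0 := exp_pos (- INR k).
have step : z ^ k.+1 <= B * (y * y ^ k.+1 * exp (- INR k)).
  by apply: (Rle_trans _ _ _ b); apply: Rmult_le_compat_l.
have step2 : (y ^ k.+1) ^ 2 <= (B * (y * y ^ k.+1 * exp (- INR k))) ^ 2 * x ^ k.+1.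
  apply: (Rle_trans _ ((z ^ k.+1) ^ 2 * x ^ k.+1)).
    rewrite -!pow_mult ![(_ * 2)%coq_nat]Nat.mul_comm !pow_mult -Rpow_mult_distr.
    by apply: pow_incr; split => //; apply: pow2_ge_0.
  apply: Rmult_le_compat_r; first exact: pow_le.
  by apply: pow_incr; split => //; apply: pow_le.
have -> : 2 * y - 2 = 2 * INR k by rewrite /y S_INR; lra.
have EE : exp (2 * INR k) * exp (- INR k) ^ 2 = 1.
  by rewrite -exp_INR_mul -exp_plus -exp_0 /=; congr exp; lra.
apply: Rmult_le_reg_r (_ : 0 < (y * y ^ k.+1 * exp (- INR k)) ^ 2) _.
  by apply: pow_lt; apply: Rmult_lt_0_compat => //; apply: Rmult_lt_0_compat.
have -> : exp (2 * INR k) / y ^ 2 * (y * y ^ k.+1 * exp (- INR k)) ^ 2 =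
    (y ^ k.+1) ^ 2 * (exp (2 * INR k) * exp (- INR k) ^ 2).
  by rewrite !Rpow_mult_distr; field; lra.
rewrite EE Rmult_1_r; apply: (Rle_trans _ _ _ step2).
by rewrite [(B * _) ^ 2]Rpow_mult_distr; right; ring.
Qed.

Lemma INR_subn m k : (k <= m)%N -> INR (m - k) = INR m - INR k.
Proof. by move=> /ssrnat.leP km; rewrite -minusE minus_INR. Qed.

Lemma pow_one_minus_ge (p e : R) (m K : nat) : 0 <= p -> 0 < e -> p * (1 + e) <= e ->
  (m <= K)%N -> exp (- (INR K * p * (1 + e))) <= (1 - p) ^ m.
Proof.
move=> p0 e0 pe mK.
have p1 : p <= 1 by nra.
have h := one_minus_ge_exp p0 e0 pe.
apply: (Rle_trans _ ((1 - p) ^ K)).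
  have -> : - (INR K * p * (1 + e)) = INR K * - (p * (1 + e)) by lra.
  by rewrite exp_INR_mul; apply: pow_incr; split => //; apply/Rlt_le/exp_pos.
rewrite -{1}(subnKC mK) pow_add -[X in _ <= X]Rmult_1_r.
apply: Rmult_le_compat_l; first by apply: pow_le; lra.
by rewrite -[X in _ <= X](pow1 (K - m)); apply: pow_incr; lra.
Qed.

(** Here [x] and [y] stand for a/r and b/r, and [L] for ln n. As h <= e K and k <= s L <= e K, at
    least (1 - 2 e) K vertices remain after removing h + k from a cluster, so [bin_weight_ge]
    applies with p q = (s L / K)^2 and contributes exp (2 k - 2) / k^2. The non-edges cost at most a
    factor exp (- (1 + e) (x + y) L). The constant -4 is -2 from [bin_weight_ge] and -2 from
    rounding k down. *)
Lemma mean_good_ge (K h k : nat) (x y e L : R)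
    (p := x * L / INR K) (q := y * L / INR K) (s := sqrt (x * y)) :
  0 < y -> y <= x -> 0 < L -> 0 < e <= / 4 -> 1 <= e * INR K ->
  INR h <= e * INR K < INR h + 1 ->
  INR k <= (1 - 2 * e) * s * L < INR k + 1 -> (0 < k)%N ->
  s * L <= e * INR K -> p * (1 + e) <= e ->
  e * INR K / 2 * exp (- (((1 + e) * (x + y) - 2 * (1 - 2 * e) * s) * L) - 4) /
    (s * L) ^ 2 <=
  INR h * (INR 'C(K - h, k) ^ 2 *
    (p ^ k * (1 - p) ^ (K.-1 - k) * (q ^ k * (1 - q) ^ (K - k)))).
Proof.
move=> y0 yx L0 [e0 e4] eK [h1 h2] [k1 k2] kpos sL pe.
have K0 : 0 < INR K by nra.
have x0 : 0 < x by lra.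
have s0 : 0 < s by apply: sqrt_lt_R0; nra.
have s2 : s * s = x * y by apply: sqrt_sqrt; nra.
have p0 : 0 <= p by apply: Rmult_le_pos; [nra|apply/Rlt_le/Rinv_0_lt_compat].
have q0 : 0 <= q by apply: Rmult_le_pos; [nra|apply/Rlt_le/Rinv_0_lt_compat].
have qp : q <= p.
  by apply: Rmult_le_compat_r; [apply/Rlt_le/Rinv_0_lt_compat|nra].
have qe : q * (1 + e) <= e.
  by apply: Rle_trans pe; apply: Rmult_le_compat_r => //; lra.
have sL0 : 0 < s * L by exact: Rmult_lt_0_compat.
have esL : 0 < e * (s * L) by exact: Rmult_lt_0_compat.
have k1' : INR k <= s * L by lra.
have kR : 1 <= INR k by apply: (le_INR 1); apply/ssrnat.leP.
(* Together with e K < h + 1 this gives h >= e K / 2, the source of the factor 1/2. *)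
have h1' : 1 <= INR h.
  have : 0 < INR h by lra.
  by case: (h) => [|h' _]; [rewrite /=; lra|rewrite S_INR; have := pos_INR h'; lra].
have hK : (h <= K)%N by apply/ssrnat.leP/INR_le; nra.
have khK : (k <= K - h)%N by apply/ssrnat.leP/INR_le; rewrite INR_subn //; nra.
have mR : (1 - 2 * e) * INR K <= INR (K - h - k) by rewrite !INR_subn //; nra.
have pq : p * q = (s * L) ^ 2 / INR K ^ 2.
  rewrite /p /q; transitivity (x * y * (L * L / INR K ^ 2)); first by field; lra.
  by rewrite -s2; field; lra.
have bw : exp (2 * INR k - 2) / INR k ^ 2 <= INR 'C(K - h, k) ^ 2 * (p * q) ^ k.
  apply: bin_weight_ge => //; first exact: Rmult_le_pos.
  apply: (Rle_trans _ (((1 - 2 * e) * s * L) ^ 2)).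
    by apply: pow_incr; split => //; exact: pos_INR.
  have -> : ((1 - 2 * e) * s * L) ^ 2 = ((1 - 2 * e) * INR K) ^ 2 * (p * q).
    by rewrite pq; field; lra.
  apply: Rmult_le_compat_r; first exact: Rmult_le_pos.
  by apply: pow_incr; split => //; nra.
have wp := @pow_one_minus_ge p e (K.-1 - k) K p0 e0 pe (leq_trans (leq_subr _ _) (leq_pred _)).
have wq := @pow_one_minus_ge q e (K - k) K q0 e0 qe (leq_subr _ _).
have Kp : INR K * p = x * L by rewrite /p; field; lra.
have Kq : INR K * q = y * L by rewrite /q; field; lra.
rewrite Kp in wp; rewrite Kq in wq.
have -> : INR h * (INR 'C(K - h, k) ^ 2 *
    (p ^ k * (1 - p) ^ (K.-1 - k) * (q ^ k * (1 - q) ^ (K - k)))) =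
    INR h * ((INR 'C(K - h, k) ^ 2 * (p * q) ^ k) *
     ((1 - p) ^ (K.-1 - k) * (1 - q) ^ (K - k))).
  by rewrite Rpow_mult_distr; ring.
have -> : e * INR K / 2 * exp (- (((1 + e) * (x + y) - 2 * (1 - 2 * e) * s) * L) - 4) /
    (s * L) ^ 2 = e * INR K / 2 * ((exp (2 * ((1 - 2 * e) * s * L - 1) - 2) / (s * L) ^ 2) *
     (exp (- (x * L * (1 + e))) * exp (- (y * L * (1 + e))))).
  rewrite -exp_plus; set E1 := exp (2 * _ - 2); set E2 := exp (- _ + _).
  have -> : exp (- (((1 + e) * (x + y) - 2 * (1 - 2 * e) * s) * L) - 4) = E1 * E2.
    by rewrite /E1 /E2 -exp_plus; congr exp; ring.
  by field; split; lra.
have sL2 : 0 < (s * L) ^ 2 by exact: pow_lt.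
have pos1 u v : 0 < v -> 0 <= exp u / v.
  by move=> v0; apply: Rmult_le_pos; [apply/Rlt_le/exp_pos|apply/Rlt_le/Rinv_0_lt_compat].
apply: Rmult_le_compat; first by nra.
- apply: Rmult_le_pos; first exact: pos1.
  by apply: Rmult_le_pos; apply/Rlt_le/exp_pos.
- by lra.
apply: Rmult_le_compat; first exact: pos1.
- by apply: Rmult_le_pos; apply/Rlt_le/exp_pos.
- apply: Rle_trans bw; apply: Rmult_le_compat.
  + exact/Rlt_le/exp_pos.
  + exact/Rlt_le/Rinv_0_lt_compat.
  + case: (Rle_lt_or_eq_dec (2 * ((1 - 2 * e) * s * L - 1) - 2) (2 * INR k - 2)); first by lra.
      by move=> lt; apply/Rlt_le/exp_increasing.
    by move=> ->; apply: Rle_refl.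
  + apply: Rinv_le_contravar; first by apply: pow_lt; lra.
    by apply: pow_incr; lra.
by apply: Rmult_le_compat => //; apply/Rlt_le/exp_pos.
Qed.

(** * Choice of parameters below the threshold *)

(** The left side is the square (sqrt a - sqrt b)^2 / t, and both sides of the hypothesis are
    positive, so it may be squared. *)
Lemma subcritical_exponent (a b t : R) : 0 < b -> b < a -> 0 < t ->
  sqrt a - sqrt b < sqrt t ->
  a / t + b / t - 2 * sqrt (a / t * (b / t)) < 1.
Proof.
move=> b0 ba t0 ht.
have u2 : sqrt a * sqrt a = a by apply: sqrt_sqrt; lra.
have v2 : sqrt b * sqrt b = b by apply: sqrt_sqrt; lra.
have w2 : sqrt t * sqrt t = t by apply: sqrt_sqrt; lra.
have v0 : 0 < sqrt b by apply: sqrt_lt_R0.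
have uv : sqrt b < sqrt a by apply: sqrt_lt_1; lra.
have -> : a / t * (b / t) = (sqrt a * sqrt b / t) ^ 2.
  by rewrite -{1}u2 -{1}v2; field; lra.
rewrite sqrt_pow2; last first.
  by apply: Rmult_le_pos; [nra|apply/Rlt_le/Rinv_0_lt_compat].
have -> : a / t + b / t - 2 * (sqrt a * sqrt b / t) = (sqrt a - sqrt b) ^ 2 / t.
  by rewrite -{1}u2 -{1}v2; field; lra.
apply: (Rmult_lt_reg_r t) => //.
have -> : (sqrt a - sqrt b) ^ 2 / t * t = (sqrt a - sqrt b) ^ 2 by field; lra.
nra.
Qed.

Lemma le_div_of_mul_le (u v w : R) : 0 < w -> u * w <= v -> u <= v / w.
Proof.
move=> w0 h; apply: (Rmult_le_reg_r w) => //.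
by have -> : v / w * w = v by [field; lra].
Qed.

Lemma mul_ge_of_ge_div (u v w : R) : 0 < w -> v / w <= u -> v <= u * w.
Proof.
move=> w0 h; have -> : v = v / w * w by field; lra.
by apply: Rmult_le_compat_r => //; lra.
Qed.

(** With h close to e K and k close to (1 - 2 e) s L, the mean [mu] is at least a constant times L =
    ln n, while p is at most a constant over L. Every term of the error is therefore of order 1 /
    L. *)
Lemma subcritical_bound_small (r : nat) (a b eps : R) :
  (1 < r)%N -> 0 < b -> b < a -> sqrt a - sqrt b < sqrt (INR r) -> 0 < eps ->
  exists N : nat, forall K : nat, (N <= K)%N -> exists h k : nat,
    let p := p_in a (r * K) in let q := p_in b (r * K) in
    let mu := INR h * (INR 'C(K - h, k) ^ 2 *
      (p ^ k * (1 - p) ^ (K.-1 - k) * (q ^ k * (1 - q) ^ (K - k)))) in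
    [/\ (h < K)%N, 0 <= p < 1, 0 <= q <= 1, 0 < mu &
        8 * (/ mu + p / (1 - p)) + 4 / mu ^ 2 < eps].
Proof.
move=> r1 b0 ba hr eps0.
set t := INR r in hr *.
have t2 : 2 <= t by apply: (le_INR 2); apply/ssrnat.leP.
have t0 : 0 < t by lra.
have ti : 0 < / t by apply: Rinv_0_lt_compat.
have crit := subcritical_exponent b0 ba t0 hr.
set x := a / t in crit *; set y := b / t in crit *; set s := sqrt _ in crit *.
have y0 : 0 < y by apply: Rmult_lt_0_compat.
have yx : y < x by apply: Rmult_lt_compat_r.
have s0 : 0 < s by apply: sqrt_lt_R0; apply: Rmult_lt_0_compat; lra.
(* [d] is half the gap between 1 and the limiting exponent. A positive [e] raises the exponent by e
   D, so e D <= d keeps it at most 1 - d, and the mean retains a factor n^d up to powers of L. *)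
set d := (1 - (x + y - 2 * s)) / 2.
have d0 : 0 < d by rewrite /d; lra.
set D := x + y + 4 * s.
have D0 : 0 < D by rewrite /D; lra.
have [e [e0 e4 eD]] : exists e, [/\ 0 < e, e <= / 4 & e * D <= d].
  exists (Rmin (/ 4) (d / D)).
  have dD : 0 < d / D by apply: Rmult_lt_0_compat => //; apply: Rinv_0_lt_compat.
  split; [by apply: Rmin_glb_lt; lra | exact: Rmin_l |].
  apply: (Rle_trans _ (d / D * D)); last by right; field; lra.
  by apply: Rmult_le_compat_r; [lra|exact: Rmin_r].
(* The constant in mu >= c1 L: put K = n / t in [mean_good_ge] and bound exp (d L) below by (d L)^3
   / 27. *)
pose c1 := e / (2 * t * s ^ 2) * exp (- (4)) * (d ^ 3 / 27).
have c10 : 0 < c1.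
  apply: Rmult_lt_0_compat; last by have : 0 < d ^ 3 by [apply: pow_lt]; lra.
  apply: Rmult_lt_0_compat; last exact: exp_pos.
  apply: Rmult_lt_0_compat => //; apply: Rinv_0_lt_compat.
  by apply: Rmult_lt_0_compat; [lra|apply: pow_lt].
(* Once c1 L >= 1, both 8 / mu and 4 / mu^2 are controlled by 1 / (c1 L), which gives 12 / c1; and 8
   p / (1 - p) <= 16 p <= 64 a / L. *)
pose B0 := (12 / c1 + 64 * a) / eps.
have c1i : 0 < 12 / c1 by apply: Rdiv_lt_0_compat => //; lra.
have B00 : 0 < B0 by apply: Rdiv_lt_0_compat => //; lra.
have T1 : 0 < 4 * t / e by apply: Rdiv_lt_0_compat; lra.
have T2 : 0 < 4 * t * s / e by apply: Rdiv_lt_0_compat => //; apply: Rmult_lt_0_compat; lra.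
have T3 : 0 < 8 * a / e by apply: Rdiv_lt_0_compat; lra.
have T4 : 0 < 2 / s by apply: Rdiv_lt_0_compat; lra.
have T5 : 0 < 1 / c1 by apply: Rdiv_lt_0_compat; lra.
(* All summands are positive, so L > L0 yields at once each lower bound on L needed below. *)
pose L0 := 1 + 4 * t / e + 4 * t * s / e + 8 * a / e + 2 / s + 1 / c1 + B0.
have [N0 [_ N0L]] := nat_floor_ex (Rlt_le _ _ (exp_pos L0)).
exists N0.+1 => K NK.
set n := INR (r * K); set L := ln n.
have nE : n = t * INR K by rewrite /n mulnE mult_INR.
have K0 : exp L0 < INR K.
  by apply: (Rlt_le_trans _ _ _ N0L); rewrite -S_INR; apply: le_INR; apply/ssrnat.leP.
have Kpos : 0 < INR K by have := exp_pos L0; lra.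
have n0 : 0 < n by rewrite nE; apply: Rmult_lt_0_compat.
have nL : exp L = n by exact: exp_ln.
have LL : L0 < L.
  by apply: exp_lt_inv; rewrite nL nE; nra.
have Lge : 1 <= L /\ 4 * t / e <= L /\ 4 * t * s / e <= L /\ 8 * a / e <= L /\
   2 / s <= L /\ 1 / c1 <= L /\ B0 < L by rewrite /L0 in LL; repeat split; lra.
case: Lge => [L1 [L2 [L3 [L4 [L5 [L6 L7]]]]]].
have Lpos : 0 < L by lra.
have sq : L ^ 2 / 4 <= n by rewrite -nL; apply: square_le_exp; lra.
have KE : INR K = n / t by rewrite nE; field; lra.
have eK u : u * 4 * t / e <= L -> u * L <= e * INR K.
  move=> hu; have := mul_ge_of_ge_div e0 hu => {}hu.
  rewrite KE; have -> : e * (n / t) = e * n / t by field; lra.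
  apply: le_div_of_mul_le => //.
  have := Rmult_le_compat_l _ _ _ (Rlt_le _ _ Lpos) hu.
  have := Rmult_le_compat_l _ _ _ (Rlt_le _ _ e0) sq.
  lra.
have eK1 : 1 <= e * INR K.
  have := eK 1; rewrite !Rmult_1_l => /(_ L2); lra.
have sLK : s * L <= e * INR K.
  by apply: eK; move: L3; have -> : s * 4 * t = 4 * t * s by ring.
have [h [h1 h2]] := nat_floor_ex (Rle_trans _ _ _ Rle_0_1 eK1).
have sL2 : 2 <= s * L.
  by rewrite Rmult_comm; apply: mul_ge_of_ge_div.
have kx : 1 <= (1 - 2 * e) * s * L.
  have -> : (1 - 2 * e) * s * L = (1 - 2 * e) * (s * L) by ring.
  have : / 2 * 2 <= (1 - 2 * e) * (s * L) by apply: Rmult_le_compat; lra.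
  lra.
have [k [k1 k2]] := nat_floor_ex (Rle_trans _ _ _ Rle_0_1 kx).
have kpos : (0 < k)%N.
  case: (k) k2 => // /= k2; lra.
exists h, k => p q.
have pE : p = x * L / INR K by rewrite /p /p_in -/n -/L nE /x; field; lra.
have qE : q = y * L / INR K by rewrite /q /p_in -/n -/L nE /y; field; lra.
have p0 : 0 < p by rewrite pE; apply: Rdiv_lt_0_compat => //; apply: Rmult_lt_0_compat; lra.
have q0 : 0 < q by rewrite qE; apply: Rdiv_lt_0_compat => //; apply: Rmult_lt_0_compat.
have qp : q < p.
  rewrite pE qE; apply: Rmult_lt_compat_r; first exact: Rinv_0_lt_compat.
  exact: Rmult_lt_compat_r.
have p4 : p <= 4 * a / L.
  apply: le_div_of_mul_le => //; rewrite /p /p_in -/n -/L.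
  have -> : a * L / n * L = a * (L ^ 2) / n by field; lra.
  apply: (Rmult_le_reg_r n) => //.
  have -> : a * L ^ 2 / n * n = a * L ^ 2 by field; lra.
  have : a * (L ^ 2 / 4) <= a * n by apply: Rmult_le_compat_l; lra.
  lra.
have p2 : 2 * p <= e.
  have h8 := mul_ge_of_ge_div e0 L4.
  have : 8 * a / L <= e.
    apply: (Rmult_le_reg_r L) => //.
    have -> : 8 * a / L * L = 8 * a by field; lra.
    lra.
  have -> : 8 * a / L = 2 * (4 * a / L) by field; lra.
  lra.
have pe : p * (1 + e) <= e by nra.
have mu_ge := @mean_good_ge K h k x y e L y0 (Rlt_le _ _ yx) Lpos (conj e0 e4) eK1
   (conj h1 h2) (conj k1 k2) kpos sLK.
rewrite -pE -qE in mu_ge; have {}mu_ge := mu_ge pe.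
set mu := INR h * _ in mu_ge *.
have mu1 : c1 * L <= mu.
  apply: Rle_trans mu_ge.
  set E := exp _.
  have EE : exp (- (4)) * exp (d * L) <= n * E.
    rewrite -nL /E -!exp_plus.
    have le : - (4) + d * L <=
        L + (- (((1 + e) * (x + y) - 2 * (1 - 2 * e) * s) * L) - 4).
      have -> : (1 + e) * (x + y) - 2 * (1 - 2 * e) * s = 1 - 2 * d + e * D.
        by rewrite /d /D; field.
      have : e * D * L <= d * L by apply: Rmult_le_compat_r; lra.
      lra.
    case: (Rle_lt_or_eq_dec _ _ le) => [lt|->]; last exact: Rle_refl.
    exact/Rlt_le/exp_increasing.
  have cube : (d * L) ^ 3 / 27 <= exp (d * L).
    by apply: cube_le_exp; apply: Rmult_le_pos; lra.
  have -> : e * INR K / 2 * E / (s * L) ^ 2 = e / (2 * t * s ^ 2) / L ^ 2 * (n * E).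
    by rewrite KE; field; lra.
  have c0 : 0 < e / (2 * t * s ^ 2) / L ^ 2.
    apply: Rdiv_lt_0_compat; last exact: pow_lt.
    apply: Rdiv_lt_0_compat => //.
    by apply: Rmult_lt_0_compat; [lra|apply: pow_lt].
  apply: (Rle_trans _ (e / (2 * t * s ^ 2) / L ^ 2 * (exp (- (4)) * ((d * L) ^ 3 / 27)))).
    by right; rewrite /c1; field; lra.
  apply: Rmult_le_compat_l; first lra.
  by apply: Rle_trans EE; apply: Rmult_le_compat_l; [apply/Rlt_le/exp_pos|].
have cL1 : 1 <= c1 * L by rewrite Rmult_comm; apply: mul_ge_of_ge_div.
have mu0 : 0 < mu by lra.
have p1 : p < 1 by lra.
have hltK : (h < K)%N.
  by apply/ssrnat.ltP/INR_lt; apply: (Rle_lt_trans _ _ _ h1); nra.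
split => //; [by split; lra | by split; lra |].
have i1 : / mu <= / (c1 * L) by apply: Rinv_le_contravar; lra.
have i2 : 4 / mu ^ 2 <= 4 * / mu.
  have -> : 4 / mu ^ 2 = 4 * / mu * / mu by field; lra.
  rewrite -[X in _ <= X]Rmult_1_r; apply: Rmult_le_compat_l.
    by have := Rinv_0_lt_compat _ mu0; lra.
  by rewrite -Rinv_1; apply: Rinv_le_contravar; lra.
have i3 : p / (1 - p) <= 2 * p.
  apply: (Rmult_le_reg_r (1 - p)); first lra.
  have -> : p / (1 - p) * (1 - p) = p by field; lra.
  nra.
apply: (Rle_lt_trans _ ((12 / c1 + 64 * a) / L)).
  have -> : (12 / c1 + 64 * a) / L = 12 * / (c1 * L) + 16 * (4 * a / L) by field; lra.
  lra.
apply: (Rmult_lt_reg_r L) => //.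
have -> : (12 / c1 + 64 * a) / L * L = 12 / c1 + 64 * a by field; lra.
have -> : 12 / c1 + 64 * a = eps * B0 by rewrite /B0; field; lra.
exact: Rmult_lt_compat_l.
Qed.

End Asymptotics.

From mathcomp Require Import ring lra.

Section FiniteModel.
Local Open Scope ring_scope.

(** * The likelihood of a partition *)

Section FinitePart.
Context {F : realFieldType} {n : nat}.
Implicit Types (S T D : {set 'I_n}) (P : {set {set 'I_n}}) (A : adjmat n).

(** The pairs containing [i] are split off as one row. Those (x, i) with x < i appear in the other
    orientation, and symmetry of [G] turns them into entries of row [i]. *)
Lemma prod_pairs_pull (G : 'I_n -> 'I_n -> F) S i :
  (forall x y, G x y = G y x) -> i \in S ->
  \prod_(x in S) \prod_(y in S | (x < y)%N) G x y =
  (\prod_(y in S :\ i) G i y) *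
  \prod_(x in S :\ i) \prod_(y in S :\ i | (x < y)%N) G x y.
Proof.
move=> Gsym iS; rewrite (bigD1 i) //=.
have -> : \prod_(x in S | x != i) \prod_(y in S | (x < y)%N) G x y =
    \prod_(x in S :\ i) ((if (x < i)%N then G i x else 1) *
       \prod_(y in S :\ i | (x < y)%N) G x y).
  apply: eq_big => [x|x /andP[xS xi]]; first by rewrite !inE andbC.
  case: ifP => xlti.
    rewrite (bigD1 i) /=; last by rewrite iS.
    rewrite Gsym; congr (_ * _); apply: eq_bigl => y; rewrite !inE.
    by do 3?case: (_ != _); case: (_ \in _); case: (_ < _)%N.
  rewrite mul1r; apply: eq_bigl => y; rewrite !inE.
  by case: eqP => [->|]; rewrite ?xlti ?andbF.
rewrite big_split /= mulrA; congr (_ * _).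
rewrite [RHS](bigID (fun y : 'I_n => (y < i)%N)) /= mulrC; congr (_ * _).
  by rewrite -big_mkcondr.
apply: eq_bigl => y; rewrite !inE -leqNgt ltn_neqAle -(inj_eq val_inj) /= eq_sym.
by rewrite andbA [(y \in S) && _]andbC.
Qed.

Lemma sum_adj_valid (g : 'I_n -> 'I_n -> bool -> F) :
  \sum_(A : adjmat n | adj_valid A) \prod_(x : 'I_n) \prod_(y : 'I_n | (x < y)%N) g x y (A (x, y)) =
  \prod_(x : 'I_n) \prod_(y : 'I_n | (x < y)%N) (g x y true + g x y false).
Proof.
(* Pairs off the strict upper triangle get weight 1 on non-edges and 0 on edges,
   so the sum over all boolean arrays only sees the strictly upper triangular ones. *)
pose g' (e : 'I_n * 'I_n) b : F :=
  if (e.1 < e.2)%N then g e.1 e.2 b else if b then 0 else 1.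
pose upper (A : adjmat n) : adjmat n := [ffun e : 'I_n * 'I_n => (e.1 < e.2)%N && A e].
pose symm (A : adjmat n) : adjmat n :=
  [ffun e : 'I_n * 'I_n => if (e.1 < e.2)%N then A e else (e.2 < e.1)%N && A (e.2, e.1)].
have -> : \prod_(x : 'I_n) \prod_(y : 'I_n | (x < y)%N) (g x y true + g x y false) =
    \prod_(e : ('I_n * 'I_n)%type) \sum_b g' e b.
  rewrite pair_big_dep /= [RHS](bigID (fun e : 'I_n * 'I_n => (e.1 < e.2)%N)) /=.
  rewrite [X in _ = _ * X]big1 ?mulr1 => [|e /negPf e12]; last first.
    by rewrite big_bool /g' e12 /= add0r.
  by apply: eq_bigr => e e12; rewrite big_bool /g' e12.
rewrite bigA_distr_bigA /=.
rewrite [RHS](bigID (fun A : adjmat n => A == upper A)) /= [X in _ = _ + X]big1 ?addr0.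
  rewrite (reindex_onto symm upper) /=; last first.
    move=> A /andP[/forallP A0 /forallP As]; apply/ffunP => -[x y]; rewrite !ffunE /=.
    case: ltngtP => //= xy.
      by move/forallP: (As x) => /(_ y)/eqP ->.
    by have /val_inj -> := xy; rewrite (negPf (A0 y)).
  have upsymm A : upper (symm A) = upper A.
    by apply/ffunP => -[x y]; rewrite !ffunE /=; case: ltngtP.
  have validsymm A : adj_valid (symm A).
    apply/andP; split; first by apply/forallP => x; rewrite !ffunE /= ltnn.
    by apply/forallP => x; apply/forallP => y; rewrite !ffunE /=; case: ltngtP.
  apply: eq_big => [A|A]; first by rewrite validsymm upsymm eq_sym.
  rewrite validsymm upsymm /= => /eqP upA.
  rewrite pair_big_dep /= [RHS](bigID (fun e : 'I_n * 'I_n => (e.1 < e.2)%N)) /=.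
  rewrite [X in _ = _ * X]big1 ?mulr1 => [|[x y] /= /negPf xy]; last first.
    by rewrite /g' /= -upA ffunE /= xy.
  by apply: eq_bigr => -[x y] /= xy; rewrite /g' /= ffunE /= xy.
move=> A /eqP /ffunP Aup; have [/forallP nA|] := boolP [forall e, A e == upper A e].
  by case: Aup => e; apply/eqP.
rewrite negb_forall => /existsP[e]; rewrite ffunE => Ae.
rewrite (bigD1 e) //= /g'; move: Ae; case: (e.1 < e.2)%N; first by rewrite eqxx.
by case: (A e) => // _; rewrite mul0r.
Qed.
End FinitePart.

Lemma prodr_nat_bool (F : realFieldType) (I : finType) (Q : pred I) (c : I -> bool) :
  \prod_(i | Q i) (c i)%:R = [forall (i | Q i), c i]%:R :> F.
Proof.
have [/forallP cQ|] := boolP [forall (i | Q i), c i].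
  by rewrite big1 // => i Qi; move/implyP: (cQ i) => ->.
rewrite negb_forall => /existsP[i]; rewrite negb_imply => /andP[Qi /negPf ci].
by rewrite (bigD1 i) //= ci mul0r.
Qed.

Definition bern (F : realFieldType) (p : F) (b : bool) : F := if b then p else 1 - p.

Lemma bern_sum (F : realFieldType) (p : F) : bern p true + bern p false = 1.
Proof. by rewrite /bern addrC subrK. Qed.

Lemma bern_ge0 (F : realFieldType) (p : F) b : 0 <= p <= 1 -> 0 <= bern p b.
Proof. by case/andP=> p0 p1; case: b => //=; rewrite subr_ge0. Qed.

Lemma prod_bern (F : realFieldType) (I : finType) (p : F) (S T : {set I}) :
  \prod_(y in S) bern p (y \in T) = p ^+ #|S :&: T| * (1 - p) ^+ #|S :\: T|.
Proof.
rewrite (bigID (mem T)) /=; congr (_ * _).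
  rewrite (eq_bigr (fun=> p)) => [|y /andP[_ ->] //].
  by rewrite prodr_const; congr (_ ^+ _); apply: eq_card => y; rewrite !inE.
rewrite (eq_bigr (fun=> 1 - p)) => [|y /andP[_ /negPf ->] //].
by rewrite prodr_const; congr (_ ^+ _); apply: eq_card => y; rewrite !inE andbC.
Qed.

Section Likelihood.
Context {F : realFieldType} {n : nat} (p q : F) (P : {set {set 'I_n}}).
Implicit Types (S T D : {set 'I_n}) (A : adjmat n).

Definition edge_prob (x y : 'I_n) : F := if pblock P x == pblock P y then p else q.

(** The counterpart of [sbm_prob] over any real field with free edge probabilities. Over the reals,
    with [p_in a] and [p_in b], the two are convertible. *)
Definition lik A : F :=
  if adj_valid A then
    \prod_(x : 'I_n) \prod_(y : 'I_n | (x < y)%N) bern (edge_prob x y) (A (x, y))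
  else 0.

Lemma edge_probC x y : edge_prob x y = edge_prob y x.
Proof. by rewrite /edge_prob eq_sym. Qed.

Lemma adj_valid_sym A x y : adj_valid A -> A (x, y) = A (y, x).
Proof. by case/andP=> _ /forallP /(_ x) /forallP /(_ y) /eqP. Qed.

Lemma lik_ge0 A : 0 <= p <= 1 -> 0 <= q <= 1 -> 0 <= lik A.
Proof.
move=> hp hq; rewrite /lik; case: ifP => // _.
by do 2!apply: prodr_ge0 => ? _; apply: bern_ge0; rewrite /edge_prob; case: ifP.
Qed.

(** Independence of the pairs: the expectation of a product of functions of single pairs is the
    product of their expectations. *)
Lemma sum_lik_prod (h : 'I_n -> 'I_n -> bool -> F) :
  \sum_A lik A * (\prod_(x : 'I_n) \prod_(y : 'I_n | (x < y)%N) h x y (A (x, y))) =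
  \prod_(x : 'I_n) \prod_(y : 'I_n | (x < y)%N)
    (bern (edge_prob x y) true * h x y true + bern (edge_prob x y) false * h x y false).
Proof.
rewrite -(sum_adj_valid (fun x y b => bern (edge_prob x y) b * h x y b)).
rewrite [RHS]big_mkcond; apply: eq_bigr => A _; rewrite /lik.
case: ifP => _; last by rewrite mul0r.
by rewrite -big_split /=; apply: eq_bigr => x _; rewrite -big_split.
Qed.

Lemma sum_lik : \sum_A lik A = 1.
Proof.
transitivity (\sum_A lik A * \prod_(x : 'I_n) \prod_(y : 'I_n | (x < y)%N) 1).
  by apply: eq_bigr => A _; rewrite big1 ?mulr1 // => x _; rewrite big1.
rewrite (sum_lik_prod (fun _ _ _ => 1)) big1 // => x _; rewrite big1 // => y _.
by rewrite !mulr1 bern_sum.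
Qed.

(** * The law of the neighbourhood of a vertex *)

Definition nbr D i A := [set y in D | A (i, y)].

Lemma prod_pairs_pullT (G : 'I_n -> 'I_n -> F) i :
  (forall x y, G x y = G y x) ->
  \prod_(x : 'I_n) \prod_(y : 'I_n | (x < y)%N) G x y =
  (\prod_(y in [set~ i]) G i y) *
  \prod_(x in [set~ i]) \prod_(y in [set~ i] | (x < y)%N) G x y.
Proof.
move=> Gsym; have := prod_pairs_pull Gsym (in_setT i); rewrite setTD => <-.
by apply: eq_big => [x|x _]; rewrite ?inE //; apply: eq_bigl => y; rewrite inE.
Qed.

(** The constraint that the event [nbr D i A = T] places on the bit [b] of the pair {x, y}. It is
    vacuous unless the pair joins [i] to [D], and it is symmetric in [x] and [y] so that rows can be
    pulled out of products over pairs. *)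
Definition row_fits D i T x y b :=
  if x == i then (y \in D) ==> (b == (y \in T))
  else if y == i then (x \in D) ==> (b == (x \in T)) else true.

Lemma row_fitsC D i T x y b : row_fits D i T x y b = row_fits D i T y x b.
Proof. by rewrite /row_fits; case: (eqVneq x i) => [->|_] //; case: (eqVneq y i) => [->|_]. Qed.

Lemma nbr_eq_prod D i T A : adj_valid A -> T \subset D -> i \notin T ->
  (nbr D i A == T)%:R =
  \prod_(x : 'I_n) \prod_(y : 'I_n | (x < y)%N) (row_fits D i T x y (A (x, y)))%:R :> F.
Proof.
move=> vA TD iT.
rewrite (prod_pairs_pullT i) => [|x y]; last by rewrite row_fitsC (adj_valid_sym x y vA).
rewrite [X in _ * X]big1 ?mulr1; last first.
  move=> x; rewrite !inE => /negPf xi; rewrite big1 // => y /andP[]; rewrite !inE.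
  by rewrite /row_fits xi => /negPf ->.
rewrite prodr_nat_bool; congr (nat_of_bool _)%:R.
have A0 : A (i, i) = false by case/andP: vA => /forallP /(_ i) /negPf.
apply/eqP/forallP => [<- y|fits].
  by rewrite /row_fits eqxx !inE; apply/implyP => _; apply/implyP => ->; rewrite /= eqxx.
apply/setP => y; rewrite inE; have := fits y; rewrite !inE /row_fits eqxx.
case: eqP => [->|_] /=; first by rewrite A0 andbF (negPf iT).
have /subsetP/(_ y) := TD; case: (y \in D) => /= [_ /eqP -> //|].
by case: (y \in T) => // /(_ isT).
Qed.

Definition row_prob D i T : F := \prod_(y in D :\ i) bern (edge_prob i y) (y \in T).

(** The event is a product of constraints on single pairs. A pair outside the row from [i] to [D] is
    unconstrained, and its two weights sum to 1. *)
Lemma prob_nbr_eq D i T : T \subset D -> i \notin T ->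
  \sum_A lik A * (nbr D i A == T)%:R = row_prob D i T.
Proof.
move=> TD iT.
transitivity (\sum_A lik A *
   \prod_(x : 'I_n) \prod_(y : 'I_n | (x < y)%N) (row_fits D i T x y (A (x, y)))%:R).
  apply: eq_bigr => A _; have [vA|/negPf nvA] := boolP (adj_valid A).
    by rewrite nbr_eq_prod.
  by rewrite /lik nvA !mul0r.
rewrite (sum_lik_prod (fun x y b => (row_fits D i T x y b)%:R)).
rewrite (prod_pairs_pullT i) => [|x y]; last first.
  by rewrite edge_probC !(row_fitsC _ _ _ x y).
rewrite [X in _ * X]big1 ?mulr1; last first.
  move=> x; rewrite !inE => /negPf xi; rewrite big1 // => y /andP[]; rewrite !inE.
  by rewrite /row_fits xi => /negPf -> _; rewrite !mulr1 bern_sum.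
rewrite (bigID (mem D)) /= [X in _ * X]big1 ?mulr1.
  rewrite /row_prob; apply: eq_big => y; first by rewrite !inE.
  rewrite /row_fits eqxx => /andP[_ yD]; rewrite yD /=.
  by case: (y \in T); rewrite /= ?mulr1 ?mulr0 ?addr0 ?add0r.
by move=> y /andP[_ /negPf yD]; rewrite /row_fits eqxx yD !mulr1 bern_sum.
Qed.

(* Both events force the pair [i, j] to be a non-edge, and that is their only shared
   pair: its factor is counted once on the left and twice on the right. *)
Lemma prob_nbr_eq2 D i j T (U : {set 'I_n}) : i != j -> i \in D -> j \in D ->
  T \subset D -> U \subset D -> i \notin T -> j \notin T -> i \notin U -> j \notin U ->
  (\sum_A lik A * ((nbr D i A == T)%:R * (nbr D j A == U)%:R)) * (1 - edge_prob i j) =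
  row_prob D i T * row_prob D j U.
Proof.
move=> ij iD jD TD UD iT jT iU jU.
transitivity ((\sum_A lik A *
   \prod_(x : 'I_n) \prod_(y : 'I_n | (x < y)%N)
     (row_fits D i T x y (A (x, y)) && row_fits D j U x y (A (x, y)))%:R) *
     (1 - edge_prob i j)).
  congr (_ * _).
  apply: eq_bigr => A _; have [vA|/negPf nvA] := boolP (adj_valid A).
    rewrite !nbr_eq_prod // -big_split /=; congr (_ * _); apply: eq_bigr => x _.
    by rewrite -big_split /=; apply: eq_bigr => y _; rewrite -natrM mulnb.
  by rewrite /lik nvA !mul0r.
rewrite (sum_lik_prod (fun x y b => (row_fits D i T x y b && row_fits D j U x y b)%:R)).
set G := fun x y => bern (edge_prob x y) true *
   (row_fits D i T x y true && row_fits D j U x y true)%:R +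
   bern (edge_prob x y) false *
   (row_fits D i T x y false && row_fits D j U x y false)%:R.
have Gsym x y : G x y = G y x by rewrite /G edge_probC !(row_fitsC _ _ _ x y).
rewrite (prod_pairs_pullT i Gsym) (@prod_pairs_pull _ _ G [set~ i] j Gsym); last first.
  by rewrite !inE eq_sym.
rewrite [X in _ * (_ * X)]big1 ?mulr1; last first.
  move=> x; rewrite !inE => /andP[/negPf xj /negPf xi]; rewrite big1 // => y.
  rewrite !inE => /andP[/andP[/negPf yj /negPf yi] _].
  by rewrite /G /row_fits xj xi yj yi !mulr1 bern_sum.
have rowi : \prod_(y in [set~ i]) G i y = row_prob D i T.
  rewrite (bigID (mem D)) /= [X in _ * X]big1 ?mulr1.
    rewrite /row_prob; apply: eq_big => y; first by rewrite !inE.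
    rewrite !inE /G /row_fits eqxx => /andP[yi yD]; rewrite yD /= (negPf ij) iD.
    case: (eqVneq y j) => [->|_]; first by rewrite (negPf jT) (negPf iU) /= mulr0 add0r mulr1.
    by case: (y \in T); rewrite /= ?mulr1 ?mulr0 ?addr0 ?add0r.
  move=> y /andP[_ yD]; rewrite /G /row_fits eqxx (negPf ij) (negPf yD) /=.
  by case: (eqVneq y j) yD => [->|_ _]; [rewrite jD|rewrite !mulr1 bern_sum].
rewrite rowi -mulrA; congr (_ * _).
rewrite /row_prob [RHS](bigD1 i) /=; last by rewrite !inE ij.
rewrite (negPf iU) /= edge_probC mulrC; congr (_ * _).
rewrite (bigID (mem D)) /= [X in _ * X]big1 ?mulr1.
  apply: eq_big => y; first by rewrite !inE; do !case: (_ == _); case: (_ \in _).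
  rewrite !inE /G /row_fits eqxx (eq_sym j i) (negPf ij) => /andP[/andP[/negPf yj /negPf yi] yD].
  rewrite yD yi /=.
  by case: (y \in U); rewrite /= ?mulr1 ?mulr0 ?addr0 ?add0r.
move=> y /andP[]; rewrite !inE => /andP[/negPf yj /negPf yi] /negPf yD.
by rewrite /G /row_fits yi eqxx (eq_sym j i) (negPf ij) yD !mulr1 bern_sum.
Qed.

End Likelihood.

(** * Second moments of vertex counts *)

(** Chebyshev's inequality: on X < mu / 2 one has 1 <= 4 (X - mu)^2 / mu^2, and the moment
    hypotheses bound the variance by mu + mu^2 p / (1 - p). *)
Lemma lower_tail_le (F : realFieldType) (I : finType) (w X : I -> F) (mu p : F) :
  (forall a, 0 <= w a) -> \sum_a w a = 1 -> \sum_a w a * X a = mu ->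
  \sum_a w a * X a ^+ 2 <= mu + mu ^+ 2 / (1 - p) -> 0 < mu -> p < 1 ->
  \sum_a w a * (X a < mu / 2)%R%:R <= 4 * (mu^-1 + p / (1 - p)).
Proof.
move=> w0 w1 EX EX2 mu0 p1.
apply: (@le_trans _ _ (\sum_a w a * (4 / mu ^+ 2 * (X a - mu) ^+ 2))).
  apply: ler_sum => a _; apply: ler_wpM2l => //.
  case: ltP => [Xa|_] /=; last by rewrite mulr_ge0 ?sqr_ge0 // divr_ge0 ?sqr_ge0.
  rewrite mulrAC ler_pdivlMr ?exprn_gt0 // mul1r.
  (* This product equals 4 (X - mu)^2 - mu^2. *)
  have : 0 <= (mu - 2 * X a) * (3 * mu - 2 * X a) by apply: mulr_ge0; lra.
  by nra.
have -> : \sum_a w a * (4 / mu ^+ 2 * (X a - mu) ^+ 2) =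
    4 / mu ^+ 2 * (\sum_a w a * X a ^+ 2 - 2 * mu * (\sum_a w a * X a) +
                   mu ^+ 2 * \sum_a w a).
  rewrite !mulr_sumr -sumrB -big_split /= mulr_sumr.
  by apply: eq_bigr => a _; ring.
rewrite EX w1.
have -> : 4 * (mu^-1 + p / (1 - p)) =
   4 / mu ^+ 2 * (mu + mu ^+ 2 / (1 - p) - 2 * mu * mu + mu ^+ 2 * 1).
  by field; apply/andP; split; lra.
by apply: ler_wpM2l; [rewrite divr_ge0 ?sqr_ge0|lra].
Qed.

Lemma mem_natr_sum (F : realFieldType) (T : finType) (S : {set T}) (x : T) :
  (x \in S)%:R = \sum_(y in S) (x == y)%:R :> F.
Proof.
have [xS|xS] := boolP (x \in S).
  rewrite (bigD1 x) //= eqxx big1 ?addr0 // => y /andP[_ yx].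
  by rewrite eq_sym (negPf yx).
by rewrite big1 // => y yS; case: eqP => // xy; rewrite xy yS in xS.
Qed.

Section CountTail.
Context {F : realFieldType} {n : nat} (p q : F) (P : {set {set 'I_n}}).
Context (D H : {set 'I_n}) (TT : {set {set 'I_n}}) (c : F).
Hypotheses (p01 : 0 <= p <= 1) (q01 : 0 <= q <= 1) (p_lt1 : p < 1).
Hypothesis HD : H \subset D.
Hypothesis TT_D : forall T, T \in TT -> T \subset D.
Hypothesis TT_H : forall T i, T \in TT -> i \in H -> i \notin T.
Hypothesis row_probE : forall T i, T \in TT -> i \in H -> row_prob p q P D i T = c.
Hypothesis edge_probE : forall i j, i \in H -> j \in H -> edge_prob p q P i j = p.

Let good A i : F := (nbr D i A \in TT)%:R.
Let EE (f : adjmat n -> F) := \sum_A lik p q P A * f A.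

Lemma mean_good i : i \in H -> EE (fun A => good A i) = #|TT|%:R * c.
Proof.
move=> iH; rewrite /EE.
under eq_bigr do rewrite /good mem_natr_sum mulr_sumr.
rewrite exchange_big /= mulr_natl -sumr_const; apply: eq_bigr => T TTT.
by rewrite prob_nbr_eq ?row_probE ?TT_D ?TT_H.
Qed.

(** Summing [prob_nbr_eq2] over the pairs of allowed neighbourhoods gives the square of the mean;
    the shared non-edge inside [H], of probability 1 - p, is counted twice in that square. *)
Lemma mean_good2 i j : i \in H -> j \in H -> i != j ->
  EE (fun A => good A i * good A j) = (#|TT|%:R * c) ^+ 2 / (1 - p).
Proof.
move=> iH jH ij; have p1 : 1 - p != 0 by rewrite subr_eq0 gt_eqF.
apply: (mulIf p1); rewrite divfK // /EE.
under eq_bigr do rewrite /good !mem_natr_sum big_distrlr /= mulr_sumr.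
have -> : (#|TT|%:R * c) ^+ 2 = \sum_(T in TT) \sum_(U in TT) c * c.
  by rewrite !sumr_const -mulrnA -[RHS]mulr_natl natrM; ring.
rewrite exchange_big /= mulr_suml; apply: eq_bigr => T TTT.
under eq_bigr do rewrite mulr_sumr.
rewrite exchange_big /= mulr_suml.
apply: eq_bigr => U UTT; rewrite -{2}(edge_probE iH jH) prob_nbr_eq2 ?TT_D ?TT_H //.
- by rewrite !row_probE.
- exact: (subsetP HD).
exact: (subsetP HD).
Qed.

(** In the second moment of the count, the diagonal terms sum to the mean because [good] takes
    values 0 and 1. The off-diagonal terms are completed to a full square by adding nonnegative
    diagonal ones. *)
Lemma count_lower_tail : 0 < #|H|%:R * (#|TT|%:R * c) ->
  EE (fun A => (\sum_(i in H) good A i < #|H|%:R * (#|TT|%:R * c) / 2)%R%:R) <=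
  4 * ((#|H|%:R * (#|TT|%:R * c))^-1 + p / (1 - p)).
Proof.
set m := #|TT|%:R * c; set mu := #|H|%:R * m => mu0.
apply: lower_tail_le => //.
- by move=> A; apply: lik_ge0.
- exact: sum_lik.
- under eq_bigr do rewrite mulr_sumr.
  rewrite exchange_big /= /mu mulr_natl -sumr_const.
  by apply: eq_bigr => i iH; rewrite /m -(mean_good iH).
have -> : \sum_A lik p q P A * (\sum_(i in H) good A i) ^+ 2 =
    \sum_(i in H) (m + \sum_(j in H | j != i) m ^+ 2 / (1 - p)).
  under eq_bigr do rewrite expr2 big_distrlr /= mulr_sumr.
  rewrite exchange_big /=; apply: eq_bigr => i iH.
  under eq_bigr do rewrite mulr_sumr.
  rewrite exchange_big /= (bigD1 i) //=; congr (_ + _).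
    rewrite /m -(mean_good iH) //; apply: eq_bigr => A _; congr (_ * _).
    by rewrite /good -natrM mulnb andbb.
  by apply: eq_bigr => j /andP[jH ji]; rewrite /m -(mean_good2 iH jH) // eq_sym.
rewrite big_split /= sumr_const -[m *+ _]mulr_natl lerD2l /mu [(_ * m) ^+ 2]exprMn.
rewrite [X in _ <= X](_ : _ = \sum_(i in H) \sum_(j in H) m ^+ 2 / (1 - p)); last first.
  by rewrite !sumr_const -!mulrnA -[RHS]mulr_natl natrM; ring.
apply: ler_sum => i iH; rewrite [X in _ <= X](bigD1 i) //= lerDr.
by rewrite divr_ge0 ?sqr_ge0 ?subr_ge0 // ltW.
Qed.
End CountTail.

(** * Swapping two vertices *)

Section Swap.
Context {n : nat}.
Implicit Types (P : {set {set 'I_n}}) (s : {perm 'I_n}) (B : {set 'I_n}).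

Definition relabel s P : {set {set 'I_n}} := [set s @: (B : {set 'I_n}) | B in P].

Lemma partition_relabel s P :
  partition P [set: 'I_n] -> partition (relabel s P) [set: 'I_n].
Proof.
rewrite -(imset_partition _ _ (@perm_inj _ s)); congr (partition _ _).
by apply/setP => x; rewrite !inE; apply/imsetP; exists (s^-1 x)%g; rewrite ?permKV.
Qed.

Lemma balanced_relabel s P r K :
  balanced_partition r K P -> balanced_partition r K (relabel s P).
Proof.
case/and3P=> partP cardP /forallP cardB; apply/and3P; split.
- exact: partition_relabel.
- by rewrite card_imset //; apply/imset_inj/perm_inj.
apply/forallP => B; apply/implyP => /imsetP[B' B'P ->].
by rewrite card_imset; [apply: (implyP (cardB B'))|apply: perm_inj].
Qed.

Lemma pblock_relabel s P x : partition P [set: 'I_n] ->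
  pblock (relabel s P) (s x) = s @: pblock P x.
Proof.
move=> partP; have /and3P[_ triv' _] := partition_relabel s partP.
have /and3P[/eqP cov triv _] := partP.
apply: def_pblock => //; first by rewrite imset_f // pblock_mem // cov.
by rewrite imset_f // mem_pblock cov.
Qed.

Lemma same_block_relabel i j P x y : partition P [set: 'I_n] ->
  (pblock (relabel (tperm i j) P) x == pblock (relabel (tperm i j) P) y) =
  (pblock P (tperm i j x) == pblock P (tperm i j y)).
Proof.
move=> partP; rewrite -{1}[x](tpermK i j) -{1}[y](tpermK i j) !pblock_relabel //.
by rewrite (inj_eq (imset_inj (@perm_inj _ _))).
Qed.
End Swap.

Section Tie.
Context {F : realFieldType} {n : nat} (p q : F) (P : {set {set 'I_n}}).
Context (C1 C2 : {set 'I_n}) (k : nat) (A : adjmat n).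
Hypothesis partP : partition P [set: 'I_n].
Hypotheses (C1P : C1 \in P) (C2P : C2 \in P) (C12 : C1 != C2) (cardC : #|C1| = #|C2|).

Lemma pblock_eqE C x y : C \in P -> x \in C -> (pblock P x == pblock P y) = (y \in C).
Proof.
case/and3P: partP => /eqP cov triv _ CP xC; rewrite (def_pblock triv CP xC).
apply/eqP/idP => [->|yC]; first by rewrite mem_pblock cov.
by rewrite (def_pblock triv CP yC).
Qed.

(** Within [C1] and [C2] the products depend only on the numbers of edges and non-edges. After the
    removal of [i] and [j], which are not adjacent to [u], both clusters have k edges and |C1| - 1 -
    k non-edges, so exchanging the roles of p and q changes nothing. Every vertex outside both
    clusters has weight parameter q on either side. The lemma serves for u = i and for u = j. *)
Lemma row_tie i j u : i \in C1 -> j \in C2 -> ~~ A (u, i) -> ~~ A (u, j) ->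
  #|[set y in C1 | A (u, y)]| = k -> #|[set y in C2 | A (u, y)]| = k ->
  \prod_(y in [set~ i] :\ j) bern (edge_prob p q P i y) (A (u, y)) =
  \prod_(y in [set~ i] :\ j) bern (edge_prob p q P j y) (A (u, y)).
Proof.
move=> iC jC Aui Auj k1 k2.
have dis : [disjoint C1 & C2] by case/and3P: partP => _ /trivIsetP /(_ _ _ C1P C2P C12).
have notC1 y : y \in C2 -> y \in C1 = false by move/(disjointFl dis).
have notC2 y : y \in C1 -> y \in C2 = false by move/(disjointFr dis).
pose N := [set y | A (u, y)].
have row (e : F) (C C' : {set 'I_n}) v w : C \in P -> v \in C -> w \in C' -> ~~ A (u, v) ->
    #|[set y in C | A (u, y)]| = k -> [disjoint C & C'] ->
    \prod_(y in ([set~ v] :\ w) :&: C) bern e (A (u, y)) =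
    e ^+ k * (1 - e) ^+ (#|C|.-1 - k).
  move=> CP vC wC' Auv kC dC.
  have -> : ([set~ v] :\ w) :&: C = C :\ v.
    apply/setP => y; rewrite !inE; case: (eqVneq y w) => [->|_] /=.
      by rewrite (disjointFl dC wC') andbF.
    by [].
  transitivity (\prod_(y in C :\ v) bern e (y \in N)).
    by apply: eq_bigr => y _; rewrite inE.
  have cN : #|(C :\ v) :&: N| = k.
    rewrite -kC; apply: eq_card => y; rewrite !inE.
    by case: (eqVneq y v) => [->|_] //=; rewrite (negPf Auv) andbF.
  rewrite prod_bern cN; congr (_ * _ ^+ _).
  by rewrite [#|C|](cardsD1 v) vC add1n -(cardsID N (C :\ v)) cN /= addKn.
have split_row v : \prod_(y in [set~ i] :\ j) bern (edge_prob p q P v y) (A (u, y)) =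
    \prod_(y in ([set~ i] :\ j) :&: C1) bern (edge_prob p q P v y) (A (u, y)) *
    (\prod_(y in ([set~ j] :\ i) :&: C2) bern (edge_prob p q P v y) (A (u, y)) *
    \prod_(y in ([set~ i] :\ j) :\: (C1 :|: C2)) bern (edge_prob p q P v y) (A (u, y))).
  rewrite (bigID (mem C1)) /=; congr (_ * _); first by apply: eq_bigl => y; rewrite !inE.
  rewrite (bigID (mem C2)) /=; congr (_ * _); apply: eq_bigl => y; rewrite !inE.
    by case yC2: (y \in C2); rewrite ?andbF // notC1 // !andbT andbC.
  by rewrite negb_or; do !case: (_ == _); do !case: (_ \in _).
have rowC (C : {set 'I_n}) v e (f : {set 'I_n}) : (forall y, y \in C -> edge_prob p q P v y = e) ->
   \prod_(y in f :&: C) bern (edge_prob p q P v y) (A (u, y)) =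
   \prod_(y in f :&: C) bern e (A (u, y)).
  by move=> eC; apply: eq_bigr => y; rewrite !inE => /andP[_ /eC ->].
rewrite !split_row.
rewrite (rowC C1 i p) => [|y yC]; last by rewrite /edge_prob (pblock_eqE _ C1P) // yC.
rewrite (rowC C2 i q) => [|y yC]; last by rewrite /edge_prob (pblock_eqE _ C1P) // notC1.
rewrite (rowC C1 j q) => [|y yC]; last by rewrite /edge_prob (pblock_eqE _ C2P) // notC2.
rewrite (rowC C2 j p) => [|y yC]; last by rewrite /edge_prob (pblock_eqE _ C2P) // yC.
have dis' : [disjoint C2 & C1] by rewrite disjoint_sym.
rewrite !(row _ C1 C2 i j) // !(row _ C2 C1 j i) // cardC.
have -> : \prod_(y in ([set~ i] :\ j) :\: (C1 :|: C2)) bern (edge_prob p q P i y) (A (u, y)) =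
    \prod_(y in ([set~ i] :\ j) :\: (C1 :|: C2)) bern (edge_prob p q P j y) (A (u, y)).
  apply: eq_bigr => y; rewrite !inE negb_or => /andP[/andP[/negPf y1 /negPf y2] _].
  by rewrite /edge_prob (pblock_eqE _ C1P) // (pblock_eqE _ C2P) // y1 y2.
by ring.
Qed.

(** Only pairs meeting {i, j} can change weight. The pair {i, j} itself keeps its weight, while the
    row of [i] is weighted as if [i] belonged to the cluster of [j] and conversely; [row_tie] undoes
    both changes. *)
Lemma lik_swap i j : i \in C1 -> j \in C2 ->
  ~~ A (i, j) ->
  #|[set y in C1 | A (i, y)]| = k -> #|[set y in C2 | A (i, y)]| = k ->
  #|[set y in C1 | A (j, y)]| = k -> #|[set y in C2 | A (j, y)]| = k ->
  lik p q (relabel (tperm i j) P) A = lik p q P A.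
Proof.
move=> iC jC Aij i1 i2 j1 j2; rewrite /lik; case: ifP => // vA.
have dis : [disjoint C1 & C2] by case/and3P: partP => _ /trivIsetP /(_ _ _ C1P C2P C12).
have ij : i != j by apply: contraTneq iC => ->; rewrite (disjointFl dis jC).
have A0 v : ~~ A (v, v) by case/andP: vA => /forallP /(_ v).
have Aji : ~~ A (j, i) by rewrite (adj_valid_sym j i vA).
set P' := relabel _ P.
have ewP' x y : edge_prob p q P' x y = edge_prob p q P (tperm i j x) (tperm i j y).
  by rewrite /edge_prob same_block_relabel.
have sym P0 x y : bern (edge_prob p q P0 x y) (A (x, y)) =
    bern (edge_prob p q P0 y x) (A (y, x)) by rewrite edge_probC (adj_valid_sym x y vA).
have jS : j \in [set~ i] by rewrite !inE eq_sym.
rewrite (prod_pairs_pullT i (sym P')) (prod_pairs_pullT i (sym P)).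
rewrite (prod_pairs_pull (sym P') jS) (prod_pairs_pull (sym P) jS) !mulrA.
have fix_ y : y \in [set~ i] :\ j -> tperm i j y = y.
  by rewrite !inE => /andP[yj yi]; rewrite tpermD // eq_sym.
congr (_ * _); last first.
  apply: eq_bigr => x xS; apply: eq_bigr => y /andP[yS _].
  by rewrite ewP' !fix_.
rewrite !(bigD1 j jS) /= ewP' tpermL tpermR (edge_probC _ _ _ j i) -!mulrA; congr (_ * _).
have -> : \prod_(y in [set~ i] | y != j) bern (edge_prob p q P' i y) (A (i, y)) =
    \prod_(y in [set~ i] :\ j) bern (edge_prob p q P i y) (A (i, y)).
  rewrite (@row_tie i j) //; apply: eq_big => y; first by rewrite !inE andbC.
  by move=> yS; rewrite ewP' tpermL fix_ // !inE andbC; move: yS; rewrite !inE.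
have -> : \prod_(y in [set~ i] :\ j) bern (edge_prob p q P' j y) (A (j, y)) =
    \prod_(y in [set~ i] :\ j) bern (edge_prob p q P j y) (A (j, y)).
  rewrite -(@row_tie i j) //; apply: eq_bigr => y yS.
  by rewrite ewP' tpermR fix_.
congr (_ * _); apply: eq_bigl => y.
by rewrite in_setD1; apply: andbC.
Qed.
End Tie.

Lemma ex_subset_card (T : finType) (B : {set T}) h : (h <= #|B|)%N ->
  exists2 H : {set T}, H \subset B & #|H| = h.
Proof.
move=> hB; exists [set x in take h (enum B)].
  by apply/subsetP => x; rewrite inE => /mem_take; rewrite mem_enum.
rewrite cardsE; have /card_uniqP -> : uniq (take h (enum B)) by rewrite take_uniq ?enum_uniq.
by rewrite size_takel // -cardE.
Qed.

(** * Good vertices of two clusters and the ties they create *)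

Definition tied (F : realFieldType) n (p q : F) r K (P : {set {set 'I_n}}) (A : adjmat n) :=
  [set P' | balanced_partition r K P' & lik p q P' A == lik p q P A].

Section TwoClusters.
Context {F : realFieldType} {n : nat} (p q : F) (P : {set {set 'I_n}}) (r K h k : nat).
Context (C1 C2 H1 H2 : {set 'I_n}).
Hypotheses (balP : balanced_partition r K P).
Hypotheses (C1P : C1 \in P) (C2P : C2 \in P) (C12 : C1 != C2).
Hypotheses (HC1 : H1 \subset C1) (HC2 : H2 \subset C2).
Hypotheses (cardH1 : #|H1| = h) (cardH2 : #|H2| = h) (hK : (h < K)%N).

(** The neighbourhoods inside [C1 :|: C2] allowed for a good vertex. Drawing from the complements of
    [H1] and [H2] keeps good vertices pairwise non-adjacent, as the swap and the second moment both
    require. *)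
Definition nbr_sets : {set {set 'I_n}} :=
  [set T.1 :|: T.2 | T in
     setX [set T1 : {set 'I_n} | T1 \subset C1 :\: H1 & #|T1| == k]
          [set T2 : {set 'I_n} | T2 \subset C2 :\: H2 & #|T2| == k]].

Definition good_vertices (H : {set 'I_n}) (A : adjmat n) :=
  [set i in H | nbr (C1 :|: C2) i A \in nbr_sets].

Lemma clusters_disjoint : [disjoint C1 & C2].
Proof. by case/and3P: balP => /and3P[_ /trivIsetP /(_ _ _ C1P C2P C12)]. Qed.

Lemma card_cluster (C : {set 'I_n}) : C \in P -> #|C| = K.
Proof. by case/and3P: balP => _ _ /forallP /(_ C) /implyP h' /h' /eqP. Qed.

Lemma nbr_setsP T : T \in nbr_sets ->
  [/\ T \subset C1 :|: C2, [disjoint T & H1 :|: H2], #|C1 :&: T| = k & #|C2 :&: T| = k].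
Proof.
case/imsetP => -[T1 T2]; rewrite !inE /= => /andP[/andP[T1C /eqP k1] /andP[T2C /eqP k2]] ->.
have dis := clusters_disjoint.
have {}T1C y : y \in T1 -> (y \in C1) && (y \notin H1).
  by move/(subsetP T1C); rewrite !inE andbC.
have {}T2C y : y \in T2 -> (y \in C2) && (y \notin H2).
  by move/(subsetP T2C); rewrite !inE andbC.
have nC1 y : y \in C2 -> y \in C1 = false by move/(disjointFl dis).
have nC2 y : y \in C1 -> y \in C2 = false by move/(disjointFr dis).
split.
- apply/subsetP => y; rewrite !inE => /orP[/T1C|/T2C] /andP[-> _] //.
  by rewrite orbT.
- rewrite -setI_eq0; apply/eqP/setP => y; rewrite !inE.
  apply/negbTE/negP => /andP[/orP[/T1C|/T2C] /andP[yC /negPf ->]] /=.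
    by rewrite ?orbF => /(subsetP HC2); rewrite nC2.
  by rewrite ?orbF => /(subsetP HC1); rewrite nC1.
- rewrite -k1; apply: eq_card => y; rewrite !inE.
  case y1: (y \in T1); first by case/andP: (T1C _ y1) => ->.
  by case y2: (y \in T2); rewrite ?andbF //=; case/andP: (T2C _ y2) => /nC1 ->.
rewrite -k2; apply: eq_card => y; rewrite !inE.
case y2: (y \in T2); first by case/andP: (T2C _ y2) => ->; rewrite orbT.
by case y1: (y \in T1); rewrite ?andbF //=; case/andP: (T1C _ y1) => /nC2 ->.
Qed.

(** The union determines its two halves, as its intersections with the disjoint clusters [C1] and
    [C2]. *)
Lemma card_nbr_sets : #|nbr_sets| = ('C(K - h, k) ^ 2)%N.
Proof.
have dis := clusters_disjoint.
rewrite card_in_imset; last first.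
  move=> [T1 T2] [U1 U2]; rewrite !inE /=.
  move=> /andP[/andP[T1C _] /andP[T2C _]] /andP[/andP[U1C _] /andP[U2C _]] /setP TU.
  have sub C H (T : {set 'I_n}) : T \subset C :\: H -> forall y, y \in T -> y \in C.
    by move=> TC y /(subsetP TC); rewrite !inE => /andP[].
  congr (_, _); apply/setP => y; have := TU y; rewrite !inE.
    case yC: (y \in C1).
      have nC2 := disjointFr dis yC.
      have -> : y \in T2 = false by apply: contraFF nC2 => /(sub _ _ _ T2C).
      have -> : y \in U2 = false by apply: contraFF nC2 => /(sub _ _ _ U2C).
      by rewrite !orbF.
    have -> : y \in T1 = false by apply: contraFF yC => /(sub _ _ _ T1C).
    by have -> : y \in U1 = false by apply: contraFF yC => /(sub _ _ _ U1C).
  case yC: (y \in C2).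
    have nC1 := disjointFl dis yC.
    have -> : y \in T1 = false by apply: contraFF nC1 => /(sub _ _ _ T1C).
    by have -> : y \in U1 = false by apply: contraFF nC1 => /(sub _ _ _ U1C).
  have -> : y \in T2 = false by apply: contraFF yC => /(sub _ _ _ T2C).
  by have -> : y \in U2 = false by apply: contraFF yC => /(sub _ _ _ U2C).
rewrite cardsX !cards_draws !cardsD (setIidPr HC1) (setIidPr HC2).
by rewrite (card_cluster C1P) (card_cluster C2P) cardH1 cardH2 mulnn.
Qed.

Lemma nbr_card (A : adjmat n) i (C : {set 'I_n}) : C \subset C1 :|: C2 ->
  #|[set y in C | A (i, y)]| = #|C :&: nbr (C1 :|: C2) i A|.
Proof.
move=> CD; apply: eq_card => y; rewrite !in_set.
by have := subsetP CD y; rewrite in_setU; case: (y \in C) => //= /(_ isT) ->.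
Qed.

Lemma tied_ge A : (#|good_vertices H1 A| * #|good_vertices H2 A| <= #|tied p q r K P A|)%N.
Proof.
have dis := clusters_disjoint.
have partP : partition P [set: 'I_n] by case/and3P: balP.
have nC1 y : y \in C2 -> y \in C1 = false by move/(disjointFl dis).
have nC2 y : y \in C1 -> y \in C2 = false by move/(disjointFr dis).
(* Because h < K, each cluster keeps a vertex outside its chosen subset. These two vertices are
   fixed by every swap and let different swaps be told apart. *)
have outside (C H : {set 'I_n}) : C \in P -> #|H| = h -> exists2 c, c \in C & c \notin H.
  move=> CP cH; have : (0 < #|C :\: H|)%N.
    by rewrite cardsD (card_cluster CP) subn_gt0 (leq_ltn_trans _ hK) //
      -cH subset_leq_card ?subsetIr.
  by case/card_gt0P => c; rewrite inE => /andP[cnH cC]; exists c.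
have [c1 c1C c1H] := outside C1 H1 C1P cardH1.
have [c2 c2C c2H] := outside C2 H2 C2P cardH2.
rewrite -cardsX -(@card_in_imset _ _ (fun e => relabel (tperm e.1 e.2) P)).
  apply/subset_leq_card/subsetP => _ /imsetP[[i j] /[!inE]/= /andP[/andP[iH iT] /andP[jH jT]] ->].
  have [_ di i1 i2] := nbr_setsP iT; have [_ dj j1 j2] := nbr_setsP jT.
  have iC := subsetP HC1 _ iH; have jC := subsetP HC2 _ jH.
  rewrite balanced_relabel //=; apply/eqP; apply: (@lik_swap _ _ _ _ _ C1 C2 k) => //.
  - by rewrite !card_cluster.
  - have : j \notin nbr (C1 :|: C2) i A.
      by rewrite (disjointFl di) // inE jH orbT.
    by rewrite !inE jC orbT.
  - by rewrite nbr_card ?subsetUl.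
  - by rewrite nbr_card ?subsetUr.
  - by rewrite nbr_card ?subsetUl.
  - by rewrite nbr_card ?subsetUr.
(* [c1] and [c2] never move, so the swap can be read off the relabelled partition:
   [i] is the only vertex of [H1] separated from [c1]. *)
have moved1 i j x : i \in H1 -> j \in H2 -> x \in H1 ->
    (pblock (relabel (tperm i j) P) c1 == pblock (relabel (tperm i j) P) x) = (x != i).
  move=> iH jH xH; have jC := subsetP HC2 _ jH; have xC := subsetP HC1 _ xH.
  rewrite same_block_relabel //.
  rewrite [tperm i j c1]tpermD; last 2 first.
  - by apply: contraNneq c1H => <-.
  - by apply: contraTneq c1C => <-; rewrite nC1.
  rewrite (pblock_eqE partP _ C1P c1C); case: (eqVneq x i) => [->|xi].
    by rewrite tpermL nC1.
  by rewrite tpermD ?xC // 1?eq_sym //; apply: contraTneq xC => ->; rewrite nC1.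
have moved2 i j x : i \in H1 -> j \in H2 -> x \in H2 ->
    (pblock (relabel (tperm i j) P) c2 == pblock (relabel (tperm i j) P) x) = (x != j).
  move=> iH jH xH; have iC := subsetP HC1 _ iH; have xC := subsetP HC2 _ xH.
  rewrite same_block_relabel //.
  rewrite [tperm i j c2]tpermD; last 2 first.
  - by apply: contraTneq c2C => <-; rewrite nC2.
  - by apply: contraNneq c2H => <-.
  rewrite (pblock_eqE partP _ C2P c2C); case: (eqVneq x j) => [->|xj].
    by rewrite tpermR nC2.
  by rewrite tpermD ?xC //; [apply: contraTneq xC => <-; rewrite nC2 | rewrite eq_sym].
move=> [i j] [i' j'] /[!inE]/= /andP[/andP[iH _] /andP[jH _]] /andP[/andP[iH' _] /andP[jH' _]] eqP'.
have := moved1 i j i iH jH iH; rewrite eqP' moved1 // eqxx => /negbFE /eqP ->.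
by have := moved2 i j j iH jH jH; rewrite eqP' moved2 // eqxx => /negbFE /eqP ->.
Qed.

End TwoClusters.

(** * Bounding the success probability *)

(** The probability that a vertex has one prescribed neighbourhood with k vertices in its own
    cluster, where K - 1 candidates exist, and k in another cluster, where there are K. *)
Definition row_weight (F : realFieldType) (p q : F) (K k : nat) : F :=
  p ^+ k * (1 - p) ^+ (K.-1 - k) * (q ^+ k * (1 - q) ^+ (K - k)).

Section TieTail.
Context {F : realFieldType} {n : nat} (p q : F) (r K h k : nat).
Hypotheses (p01 : 0 <= p <= 1) (q01 : 0 <= q <= 1) (p_lt1 : p < 1) (hK : (h < K)%N).

Lemma row_prob_two_clusters (P : {set {set 'I_n}}) C C' i (T : {set 'I_n}) :
  balanced_partition r K P -> C \in P -> C' \in P -> C != C' ->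
  i \in C -> i \notin T -> #|C :&: T| = k -> #|C' :&: T| = k ->
  row_prob p q P (C :|: C') i T = row_weight p q K k.
Proof.
move=> balP CP C'P CC' iC iT k1 k2.
have dis : [disjoint C & C'] := clusters_disjoint balP CP C'P CC'.
have partP : partition P [set: 'I_n] by case/and3P: balP.
rewrite /row_prob (bigID (mem C)) /=; congr (_ * _).
  transitivity (\prod_(y in C :\ i) bern p (y \in T)).
    apply: eq_big => y; first by rewrite !inE; case: (y \in C); rewrite ?andbF ?andbT.
    by move=> /andP[_ yC]; rewrite /edge_prob (pblock_eqE partP _ CP iC) yC.
  have cN : #|(C :\ i) :&: T| = k.
    rewrite -k1; apply: eq_card => y; rewrite !inE.
    by case: (eqVneq y i) => [->|_] //=; rewrite (negPf iT) andbF.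
  rewrite prod_bern cN; congr (_ * _ ^+ _).
  by rewrite -(card_cluster balP CP) (cardsD1 i C) iC add1n -(cardsID T (C :\ i)) cN /= addKn.
transitivity (\prod_(y in C') bern q (y \in T)).
  apply: eq_big => y.
    rewrite !inE; case yC: (y \in C); first by rewrite (disjointFr dis yC) !andbF.
    by rewrite /= andbT; case: (eqVneq y i) => [yi|] //; rewrite yi iC in yC.
  by move=> /andP[_ /negPf yC]; rewrite /edge_prob (pblock_eqE partP _ CP iC) yC.
by rewrite prod_bern k2 -(card_cluster balP C'P) -(cardsID T C') k2 addKn.
Qed.

(** The ties are at least the product of the two counts of good vertices, so fewer than mu^2 / 4 of
    them forces one count below mu / 2. The union bound over the two clusters doubles the constant 4
    of [count_lower_tail]. *)
Lemma few_ties_le (P : {set {set 'I_n}})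
    (mu := h%:R * (('C(K - h, k) ^ 2)%:R * row_weight p q K k)) :
  (1 < r)%N -> balanced_partition r K P -> 0 < mu ->
  \sum_A lik p q P A * (#|tied p q r K P A|%:R < mu ^+ 2 / 4)%R%:R <=
  8 * (mu^-1 + p / (1 - p)).
Proof.
move=> r1 balP mu0.
have [partP /eqP cardP _] := and3P balP.
have : (1 < #|P|)%N by rewrite cardP.
case/card_gt1P => C1 [C2 [C1P C2P C12]].
have [|H1 HC1 cH1] := @ex_subset_card _ C1 h; first by rewrite (card_cluster balP C1P) ltnW.
have [|H2 HC2 cH2] := @ex_subset_card _ C2 h; first by rewrite (card_cluster balP C2P) ltnW.
set D := C1 :|: C2; set TT := nbr_sets k C1 C2 H1 H2.
have TTP T (TTT : T \in TT) := nbr_setsP balP C1P C2P C12 HC1 HC2 TTT.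
have cTT : #|TT| = ('C(K - h, k) ^ 2)%N by apply: (@card_nbr_sets _ P r K h k).
pose few (H : {set 'I_n}) A := (\sum_(i in H) (nbr D i A \in TT)%:R < mu / 2)%R.
have tail (C H : {set 'I_n}) : H \subset C -> C \in P -> H \subset H1 :|: H2 -> #|H| = h ->
    (forall T i, T \in TT -> i \in H -> row_prob p q P D i T = row_weight p q K k) ->
    \sum_A lik p q P A * (few H A)%:R <= 4 * (mu^-1 + p / (1 - p)).
  move=> HC CP H12 cH rowE.
  have muE : mu = #|H|%:R * (#|TT|%:R * row_weight p q K k) by rewrite cH cTT.
  rewrite /few muE; apply: count_lower_tail => //.
  - apply: (subset_trans H12); apply: setUSS => //.
  - by move=> T /TTP[].
  - move=> T i /TTP[_ dT _ _] iH; rewrite (disjointFl dT) //; exact: (subsetP H12).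
  - move=> i j iH jH; rewrite /edge_prob (pblock_eqE partP _ CP (subsetP HC _ iH)).
    by rewrite (subsetP HC _ jH).
  by rewrite -muE.
apply: (@le_trans _ _ (\sum_A lik p q P A * (few H1 A)%:R +
                       \sum_A lik p q P A * (few H2 A)%:R)); last first.
  rewrite (_ : 8 * _ = 4 * (mu^-1 + p / (1 - p)) + 4 * (mu^-1 + p / (1 - p))); last by ring.
  apply: lerD.
    apply: (tail C1) => //; first exact: subsetUl.
    move=> T i TTT iH; have [_ dT k1 k2] := TTP T TTT.
    apply: row_prob_two_clusters => //; first exact: (subsetP HC1).
    by rewrite (disjointFl dT) // inE iH.
  apply: (tail C2) => //; first exact: subsetUr.
  move=> T i TTT iH; have [_ dT k1 k2] := TTP T TTT; rewrite /D setUC.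
  apply: row_prob_two_clusters => //; first by rewrite eq_sym.
    exact: (subsetP HC2).
  by rewrite (disjointFl dT) // inE iH orbT.
rewrite -big_split /=; apply: ler_sum => A _; rewrite -mulrDr.
apply: ler_wpM2l; first exact: lik_ge0.
have countE (H : {set 'I_n}) : \sum_(i in H) (nbr D i A \in TT)%:R =
    #|good_vertices k C1 C2 H1 H2 H A|%:R :> F.
  rewrite -sum1_card natr_sum.
  rewrite [RHS](eq_bigl (fun i => (i \in H) && (nbr D i A \in TT))) => [|i]; last by rewrite inE.
  by rewrite big_mkcondr; apply: eq_bigr => i _; case: ifP.
rewrite /few !countE; set x1 : F := #|good_vertices _ _ _ _ _ H1 A|%:R.
set x2 : F := #|good_vertices _ _ _ _ _ H2 A|%:R.
have x10 : 0 <= x1 by apply: ler0n.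
have x20 : 0 <= x2 by apply: ler0n.
have : x1 * x2 <= #|tied p q r K P A|%:R.
  by rewrite -natrM ler_nat; exact: (tied_ge p q k balP C1P C2P C12 HC1 HC2 cH1 cH2 hK).
set m : F := #|tied _ _ _ _ _ _|%:R => x12.
case: (ltP x1 (mu / 2)) => [_|h1]; first by rewrite -natrD ler_nat; do 2!case: (_ < _).
case: (ltP x2 (mu / 2)) => [_|h2]; first by rewrite -natrD ler_nat; case: (_ < _).
rewrite ltNge (le_trans _ x12) ?addr0 //.
by nra.
Qed.
End TieTail.

(** For a graph with at least [t] ties, the likelihood of P is at most 1/t times the sum of the
    likelihoods of all balanced partitions. For each graph the indicators sum to at most 1 over P,
    so these terms contribute at most N / t in total, N being the number of balanced partitions.
    Graphs with fewer ties contribute at most delta for each P. *)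
Lemma sum_success_le (F : realFieldType) n (p q : F) r K (ind : adjmat n -> {set {set 'I_n}} -> F)
  (t delta : F) : 0 <= p <= 1 -> 0 <= q <= 1 -> 0 < t ->
  (forall A (P : {set {set 'I_n}}), 0 <= ind A P <= 1) ->
  (forall A, \sum_(P : {set {set 'I_n}} | balanced_partition r K P) ind A P <= 1) ->
  (forall P : {set {set 'I_n}}, balanced_partition r K P ->
    \sum_A lik p q P A * (#|tied p q r K P A|%:R < t)%R%:R <= delta) ->
  \sum_(P : {set {set 'I_n}} | balanced_partition r K P) \sum_A lik p q P A * ind A P <=
  #|[set P : {set {set 'I_n}} | balanced_partition r K P]|%:R * (delta + t^-1).
Proof.
move=> p01 q01 t0 ind01 ind1 few.
apply: (@le_trans _ _ (\sum_(P : {set {set 'I_n}} | balanced_partition r K P)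
   (\sum_A lik p q P A * (#|tied p q r K P A|%:R < t)%R%:R +
    \sum_A ind A P * (t^-1 *
      \sum_(P' : {set {set 'I_n}} | balanced_partition r K P') lik p q P' A)))).
  apply: ler_sum => P balP; rewrite -big_split /=; apply: ler_sum => A _.
  have L0 P0 : 0 <= lik p q P0 A by apply: lik_ge0.
  have /andP[i0 i1] := ind01 A P.
  case: ltP => [_|tM].
    rewrite mulr1; apply: (@le_trans _ _ (lik p q P A)); first by rewrite ler_piMr.
    rewrite lerDl; apply: mulr_ge0 => //; apply: mulr_ge0; first by rewrite invr_ge0 ltW.
    exact: sumr_ge0.
  rewrite mulr0 add0r mulrC; apply: ler_wpM2l => //.
  rewrite mulrC ler_pdivlMr //.
  apply: (@le_trans _ _ (\sum_(P' in tied p q r K P A) lik p q P' A)).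
    rewrite (eq_bigr (fun=> lik p q P A)) => [|P']; last by rewrite inE => /andP[_ /eqP].
    by rewrite sumr_const -mulr_natr; apply: ler_wpM2l.
  rewrite [X in X <= _]big_mkcond [X in _ <= X]big_mkcond /=; apply: ler_sum => P' _.
  by rewrite inE; case: balanced_partition => //=; case: ifP.
rewrite big_split /= mulrDr; apply: lerD.
  rewrite mulr_natl -sumr_const; rewrite [X in _ <= X](eq_bigl (balanced_partition r K)) => [|P].
    exact: ler_sum.
  by rewrite inE.
rewrite exchange_big /=.
apply: (@le_trans _ _ (\sum_A t^-1 *
   \sum_(P' : {set {set 'I_n}} | balanced_partition r K P') lik p q P' A)).
  apply: ler_sum => A _; rewrite -mulr_suml; apply: ler_piMl => //.
  apply: mulr_ge0; first by rewrite invr_ge0 ltW.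
  by apply: sumr_ge0 => P _; apply: lik_ge0.
rewrite -mulr_sumr exchange_big /= mulrC.
rewrite (eq_bigr (fun=> 1)) => [|P _]; last exact: sum_lik.
rewrite sumr_const; apply: ler_wpM2r; first by rewrite invr_ge0 ltW.
by rewrite le_eqVlt; apply/orP; left; apply/eqP; congr (_%:R); apply: eq_card => P; rewrite inE.
Qed.

(** * From cluster matrices to the success probability *)

Lemma ZstarE n (P : {set {set 'I_n}}) i j : partition P [set: 'I_n] ->
  Zstar P i j = (pblock P i == pblock P j)%:R :> R.
Proof.
move=> partP; have /and3P[/eqP cov triv _] := partP.
have iP : pblock P i \in P by rewrite pblock_mem // cov.
have ii : i \in pblock P i by rewrite mem_pblock cov.
transitivity (\sum_(B in P) ((if i \in B then 1 else 0) * (if j \in B then 1 else 0)) : R) => //.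
rewrite (bigD1 _ iP) /= ii mul1r big1 ?addr0 => [|B /andP[BP nB]].
  by rewrite (pblock_eqE partP j iP ii); case: ifP.
by case: ifP => iB; [|by rewrite mul0r]; rewrite -(def_pblock triv BP iB) eqxx in nB.
Qed.

(** The matrix records which vertices share a block, and a partition is the set of classes of that
    relation. Hence an estimate can be correct for at most one partition. *)
Lemma Zstar_inj n (P P' : {set {set 'I_n}}) :
  partition P [set: 'I_n] -> partition P' [set: 'I_n] -> Zstar P = Zstar P' -> P = P'.
Proof.
move=> partP partP' ZP.
rewrite -(preim_partition_pblock partP) -(preim_partition_pblock partP').
have same x y : (pblock P x == pblock P y) = (pblock P' x == pblock P' y).
  have := congr1 (fun Z => Z x y) ZP; rewrite /= !ZstarE // => /eqP.
  by rewrite eqr_nat; case: (pblock P x == _); case: (pblock P' x == _).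
rewrite /preim_partition /equivalence_partition; apply: eq_imset => x.
by apply/setP => y; rewrite !inE same.
Qed.

Lemma indicatorE (Q : Prop) : indicator Q = 0 :> R \/ (Q /\ indicator Q = 1 :> R).
Proof. by rewrite /indicator; case: excluded_middle_informative => HQ; [right|left]. Qed.

Lemma success_prob_le (r K h k : nat) (a b : R) Z
    (p := p_in a (r * K)) (q := p_in b (r * K))
    (mu := Rmult (INR h) (Rmult (pow (INR 'C(K - h, k)) 2)
      (Rmult (Rmult (pow p k) (pow (Rminus 1 p) (K.-1 - k)))
             (Rmult (pow q k) (pow (Rminus 1 q) (K - k)))))) :
  (1 < r)%N -> (h < K)%N -> Rle 0 p -> Rlt p 1 -> Rle 0 q -> Rle q 1 -> Rlt 0 mu ->
  Rle (success_prob r K a b Z)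
      (Rplus (Rmult 8 (Rplus (Rinv mu) (Rdiv p (Rminus 1 p)))) (Rdiv 4 (pow mu 2))).
Proof.
move=> r1 hK /RleP p0 /RltP p1 /RleP q0 /RleP q1 /RltP mu0.
have muE : mu = h%:R * (('C(K - h, k) ^ 2)%:R * row_weight p q K k).
  by rewrite /mu !INRE !RpowE natrX.
have p01 : 0 <= p <= 1 by rewrite p0 ltW.
have q01 : 0 <= q <= 1 by rewrite q0.
pose ind (A : adjmat (r * K)) (P : {set {set 'I_(r * K)}}) : R := indicator (Z A = Zstar P).
have ind01 A P : 0 <= ind A P <= 1.
  by rewrite /ind; case: (indicatorE (Z A = Zstar P)) => [->|[_ ->]]; rewrite !lexx ?ler01.
have ind1 A : \sum_(P : {set {set 'I_(r * K)}} | balanced_partition r K P) ind A P <= 1.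
  case: (pickP [pred P : {set {set 'I_(r * K)}} | balanced_partition r K P & ind A P == 1]).
    move=> P /andP[/= balP /eqP iP]; rewrite (bigD1 P) //= iP big1 ?addr0 // => P' /andP[balP' nP].
    rewrite /ind; case: (indicatorE (Z A = Zstar P')) => // -[ZP' _].
    case: (indicatorE (Z A = Zstar P)) => [iP0|[ZP _]].
      by move: iP; rewrite /ind iP0 => /eqP; rewrite eq_sym oner_eq0.
    case/eqP: nP; apply: Zstar_inj; [by case/and3P: balP'|by case/and3P: balP|].
    by rewrite -ZP' -ZP.
  move=> none; rewrite big1 ?ler01 // => P balP; have := none P; rewrite /= balP /= /ind.
  by case: (indicatorE (Z A = Zstar P)) => // -[_ ->]; rewrite eqxx.
have few (P : {set {set 'I_(r * K)}}) (balP : balanced_partition r K P) :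
    \sum_A lik p q P A * (#|tied p q r K P A|%:R < mu ^+ 2 / 4)%R%:R <= 8 * (mu^-1 + p / (1 - p)).
  by rewrite muE; apply: few_ties_le => //; rewrite -muE.
have t0 : 0 < mu ^+ 2 / 4 by rewrite divr_gt0 ?exprn_gt0.
have main := sum_success_le p01 q01 t0 ind01 ind1 few.
apply/RleP.
set N := #|[set P : {set {set 'I_(r * K)}} | balanced_partition r K P]| in main *.
have -> : success_prob r K a b Z =
   N%:R^-1 * \sum_(P : {set {set 'I_(r * K)}} | balanced_partition r K P)
     \sum_A lik p q P A * ind A P.
  by rewrite -INRE.
rewrite RplusE !RmultE RplusE !RdivE RpowE (IZRposE 8) (IZRposE 4) !INRE RminusE RinvE.
rewrite -[4 / mu ^+ 2]invf_div.
(* If there were no balanced partition, the inverse of 0 would be 0 and the success probability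
   would vanish; otherwise the bound is divided by N. *)
have [N0|N0] := posnP N.
  have p1' : 0 < 1 - p by rewrite subr_gt0.
  have mu0' : 0 <= mu^-1 by rewrite invr_ge0 ltW.
  have pp : 0 <= p / (1 - p) by apply: divr_ge0 => //; exact: ltW.
  rewrite N0 invr0 mul0r; apply: addr_ge0.
    by apply: mulr_ge0 => //; exact: addr_ge0.
  by rewrite invr_ge0 ltW.
by rewrite mulrC ler_pdivrMr ?ltr0n // mulrC.
Qed.

Lemma success_prob_ge0 (r K : nat) (a b : R) Z :
  Rle 0 (p_in a (r * K)) -> Rle (p_in a (r * K)) 1 ->
  Rle 0 (p_in b (r * K)) -> Rle (p_in b (r * K)) 1 -> Rle 0 (success_prob r K a b Z).
Proof.
move=> /RleP p0 /RleP p1 /RleP q0 /RleP q1; apply/RleP.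
have -> : success_prob r K a b Z =
   (#|[set P : {set {set 'I_(r * K)}} | balanced_partition r K P]|%:R)^-1 *
   \sum_(P : {set {set 'I_(r * K)}} | balanced_partition r K P)
     \sum_A lik (p_in a (r * K)) (p_in b (r * K)) P A * indicator (Z A = Zstar P).
  by rewrite -INRE.
apply: mulr_ge0; first by rewrite invr_ge0 ler0n.
apply: sumr_ge0 => P _; apply: sumr_ge0 => A _; apply: mulr_ge0.
  by apply: lik_ge0; apply/andP.
by case: (indicatorE (Z A = Zstar P)) => [->|[_ ->]]; rewrite ?ler01.
Qed.

End FiniteModel.

Theorem theorem5 (r : nat) (a b : R) :
  2 <= r -> Rlt R0 b -> Rlt b a -> Rlt (Rminus (sqrt a) (sqrt b)) (sqrt (INR r)) ->
  forall Zhat : forall K : nat, adjmat (r * K) -> 'I_(r * K) -> 'I_(r * K) -> R,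
  Un_cv (fun K => success_prob r K a b (Zhat K)) R0.
Proof.
move=> r2 b0 ba hr Zhat eps eps0.
have [N HN] := subcritical_bound_small r2 b0 ba hr eps0.
exists N => K NK.
have [h [k /= [hK [p0 p1] [q0 q1] mu0 small]]] := HN K (introT ssrnat.leP NK).
have le := success_prob_le (Zhat K) r2 hK p0 p1 q0 q1 mu0.
have ge := success_prob_ge0 (Zhat K) p0 (Rlt_le _ _ p1) q0 q1.
rewrite /Rdist Rminus_0_r Rabs_pos_eq //.
exact: Rle_lt_trans le small.
Qed.
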